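(* Let $a$ and $b$ be integers such that $2\le a<b\le a^2$, set $\tau:=\log_a b$, and let $q\in(1,\tau)$. Then for every $\varepsilon>0$ with $q-\varepsilon>1$ there exist a number $s$ such that $1<q-\varepsilon<s\le q$ and a tree $\mathfrak T$ in the class $\Upsilon_{a,b}$ such that the centred Hardy--Littlewood maximal operator $\mathcal M$ is bounded on $L^p(\mathfrak T)$ if and only if $p>s$.
   Context: A tree is a connected graph with no loops (cycles), identified with its set of vertices; $\nu(x)$ is the number of neighbours of the vertex $x$. For integers $a\le b$, $\Upsilon_{a,b}$ is the class of all trees such that $a+1\le\nu(x)\le b+1$ for every vertex $x$, with both values $a+1$ and $b+1$ attained. A tree carries the graph distance $d$ and the counting measure $\mu$; $|E|:=\mu(E)$, and $B_r(x):=\{y: d(x,y)\le r\}$. With $\mathbb N=\{0,1,2,\dots\}$, $$\mathcal M f(x):=\sup_{r\in\mathbb N}\frac1{|B_r(x)|}\int_{B_r(x)}|f|\,d\mu .$$ Lebesgue spaces are with respect to the counting measure, and the exponent $p$ ranges over $[1,\infty]$. *)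

(* Defs.v *)
From HB Require Import structures.
From mathcomp Require Import all_boot all_order all_algebra finmap.
From mathcomp Require Import all_classical all_reals all_analysis.

Set Implicit Arguments.
Unset Strict Implicit.
Unset Printing Implicit Defensive.
Import Order.TTheory GRing.Theory Num.Theory.
Import numFieldNormedType.Exports.

Local Open Scope classical_set_scope.

(* The vertex set may be infinite. It is pointed only because measurable types
   are pointed; nothing below depends on the chosen vertex.
   In a simple graph the only simple closed sequences that are not cycles have
   at most 2 vertices: [:: x] is excluded by irreflexivity, and [:: x; y] runs
   back and forth along one edge. *)
Record tree := Tree {
  vertex : pointedType;
  adj : rel vertex;
  adj_sym : symmetric adj;
  adj_irr : irreflexive adj;
  tree_connected : forall x y, exists c, path adj x c /\ last x c = y;
  tree_acyclic : forall c, ucycle adj c -> size c <= 2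
}.

(* Alias of the vertex type which carries the discrete sigma-algebra. *)
Definition vertices (T : tree) : Type := vertex T.
Coercion vertices : tree >-> Sortclass.

HB.instance Definition _ (T : tree) := Pointed.on (vertices T).
HB.instance Definition _ (T : tree) :=
  @isMeasurable.Build default_measure_display (vertices T)
    discrete_measurable discrete_measurable0
    discrete_measurableC discrete_measurableU.

Section tree_geometry.
Variable T : tree.
Implicit Types x y : T.

(* fset_set sends infinite sets to fset0, so nu x = 0 if x has infinitely many
   neighbours; the lower bound in Upsilon excludes this case. *)
Definition nu x : nat := #|` fset_set [set y : T | @adj T x y] |.

Definition Upsilon (a b : nat) : Prop :=
  [/\ forall x, a.+1 <= nu x <= b.+1,
      exists x, nu x = a.+1 &
      exists x, nu x = b.+1].

Definition joined x y (n : nat) : Prop :=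
  exists c : seq T, [/\ path (@adj T) x c, last x c = y & size c = n].

Lemma joined_ex x y : exists n, `[< joined x y n >].
Proof.
by have [c [xc cy]] := @tree_connected T x y; exists (size c); apply/asboolP; exists c.
Qed.

Definition tdist x y : nat := ex_minn (joined_ex x y).

Definition tball x (r : nat) : set T := [set y | tdist x y <= r].

End tree_geometry.

Local Open Scope ring_scope.
Local Open Scope ereal_scope.

Section maximal_operator.
Variables (T : tree) (R : realType).

Definition tmeasure : {measure set T -> \bar R} := @counting T R.

(* fine is harmless where it is used: all balls of a tree of class Upsilon are
   finite and nonempty. *)
Definition tmaximal (f : T -> R) (x : T) : \bar R :=
  ereal_sup [set (fine (tmeasure (tball x r)))^-1%:E *
                 \int[tmeasure]_(y in tball x r) `|f y|%:E | r in [set: nat]].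

Definition tmaximal_bounded (p : \bar R) : Prop :=
  exists C : R, forall f : T -> R, f \in Lfun tmeasure p ->
    'N[tmeasure]_p[tmaximal f] <= C%:E * 'N[tmeasure]_p[EFin \o f].

End maximal_operator.

Arguments tmeasure : clear implicits.
Arguments tmaximal_bounded T {R} p.

(* Main.v *)
From HB Require Import structures.
Require Import Defs.
From mathcomp Require Import all_boot all_order all_algebra finmap.
From mathcomp Require Import all_classical all_reals all_analysis.
From mathcomp Require Import measurable_realfun ess_sup_inf.
From mathcomp Require Import zify ring lra.
Import Order.TTheory GRing.Theory Num.Theory.
Import numFieldNormedType.Exports.

(** One tree serves all eps: the critical exponent of the tree below is q itself.

    The tree has a distinguished end. Its vertices are arranged in levels indexed
    by the integers, every vertex has one parent, one level above it, and the number
    of children depends on the level only. Every vertex of level -1 or below has a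
    children. On the levels above, the numbers of children are a or b, chosen
    greedily so that the number D n of descendants at level -1 of a vertex n levels
    above it is comparable with a ^ (q n) (n + n0); this is possible because
    a < a ^ q < b. Hence, for every gam > a ^ q and some C, a vertex has at most
    C gam ^ j descendants in the j-th generation ([breadth_greedy_le]), and at least
    a ^ j.

    For p > q take gam below a ^ p and a ^ 2, which is possible as a ^ q < b <= a ^ 2.
    Two vertices x and y meet in an ancestor lying i steps above x and j steps above
    y, and the average of f over a ball around x is at most the sum of f y divided
    by the number of descendants of x in generation i + j, which bounds the ball of
    radius i + j from below. This kernel passes Schur's test with the weight
    v ^ (level x - level y) = v ^ (i - j): the row sums are bounded by a geometric
    series in i + j ([breadth_weight_down]), because climbing i and descending j
    levels reaches at most C (gam / a ^ 2) ^ min (i, j) times as many vertices as the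
    ball of radius i + j contains ([breadth_ratio]); so are the column sums ([breadth_weight_up]), because only
    C gam ^ i vertices x see y in this way. The two requirements on v are compatible
    because gam < a ^ 2 and gam < a ^ p ([schur_parameters]).

    For p <= q let o lie n levels above level -1. Balls of radius n around vertices
    of level -1 have at most C a ^ n elements ([card_tball_le]), so the p-th power of
    the norm of the maximal function of the point mass at o is at least a constant
    times D n / a ^ (n p), which is at least a constant times n
    ([tmaximal_unbounded]). Thus the linear factor in D n excludes p = q. *)

Set Implicit Arguments.
Unset Strict Implicit.
Unset Printing Implicit Defensive.

Local Open Scope ring_scope.
Local Open Scope classical_set_scope.

(** * Powers and means *)

Lemma powR_exprn (R : realType) (v e : R) n : 0 <= v -> (v ^+ n) `^ e = (v `^ e) ^+ n.
Proof. by move=> v0; rewrite -powR_mulrn// powRAC powR_mulrn ?powR_ge0. Qed.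

Lemma ltr_powR2l (R : realType) (a x y : R) : 1 < a -> x < y -> a `^ x < a `^ y.
Proof.
move=> a1 xy; have a0 : 0 < a by apply: lt_trans a1.
by rewrite /powR gt_eqF// ltr_expR ltr_pM2r// ln_gt0.
Qed.

Lemma powR_log (R : realType) (x y : R) : 1 < x -> 0 < y -> x `^ (ln y / ln x) = y.
Proof.
move=> x1 y0; have lx0 : 0 < ln x by rewrite ln_gt0.
by rewrite /powR gt_eqF ?(lt_trans _ x1)// divfK ?gt_eqF// lnK.
Qed.

Lemma bernoulli_ge (R : realFieldType) (x : R) n : 0 <= x -> 1 + n%:R * x <= (1 + x) ^+ n.
Proof.
move=> x0; elim: n => [|n IH]; first by rewrite mul0r addr0 expr0.
rewrite exprS; apply: (@le_trans _ _ ((1 + x) * (1 + n%:R * x))); last first.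
  by rewrite ler_wpM2l// addr_ge0.
have : 0 <= n%:R * x * x by rewrite !mulr_ge0.
by rewrite -natr1; lra.
Qed.

Lemma geometric_sum_le (R : realFieldType) (x : R) (n : nat) : 0 <= x < 1 ->
  \sum_(i <- iota 0 n) x ^+ i <= (1 - x)^-1.
Proof.
move=> /andP[x0 x1]; have x1' : 0 < 1 - x by rewrite subr_gt0.
rewrite -[leRHS]mul1r ler_pdivlMr// mulrC -{1}(subn0 n) -/(index_iota 0 n) big_mkord.
by rewrite -[1 - x]opprB mulNr -subrX1 opprB gerBl exprn_ge0.
Qed.

(** Young's inequality in tangent form: the graph of t ^ p lies above its tangent
    at m. *)
Lemma powR_tangent (R : realType) (p h m : R) : 1 < p -> 0 <= h -> 0 <= m ->
  p * (h * m `^ (p - 1)) <= h `^ p + (p - 1) * m `^ p.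
Proof.
move=> p1 h0 m0; have p10 : 0 < p - 1 by rewrite subr_gt0.
have p0 : 0 < p by apply: lt_trans p1.
have := @conjugate_powR R h (m `^ (p - 1)) p (p / (p - 1)) h0 (powR_ge0 _ _) p0.
rewrite divr_gt0// => /(_ isT) H.
have {}H := H ltac:(by field; rewrite !gt_eqF).
move: H; rewrite -powRrM [(p - 1) * _]mulrC divfK ?gt_eqF// => H.
apply: le_trans (ler_wpM2l (ltW p0) H) _.
rewrite le_eqVlt; apply/orP; left; apply/eqP; field; rewrite !gt_eqF//.
Qed.

(** Jensen's inequality for t ^ p and the measure with weights al t * u t, applied
    to g / u. The factor u is the free weight of the Schur test. *)
Lemma weighted_power_mean (R : realType) (I : Type) (s : seq I) (al u g : I -> R)
    (p C : R) :
  1 < p -> (forall t, 0 <= al t) -> (forall t, 0 < u t) -> (forall t, 0 <= g t) ->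
  \sum_(t <- s) al t * u t <= C ->
  (\sum_(t <- s) al t * g t) `^ p <=
    C `^ (p - 1) * \sum_(t <- s) al t * u t * (g t / u t) `^ p.
Proof.
move=> p1 al0 u0 g0 sC; have p0 : 0 < p by apply: lt_trans p1.
have p10 : 0 < p - 1 by rewrite subr_gt0.
set S := \sum_(t <- s) _; set B := \sum_(t <- s) _ * _ * _.
have S0 : 0 <= S by apply: sumr_ge0 => t _; exact: mulr_ge0.
have B0 : 0 <= B.
  by apply: sumr_ge0 => t _; rewrite mulr_ge0 ?powR_ge0// mulr_ge0// ltW.
have C0 : 0 <= C.
  by apply: le_trans sC; apply: sumr_ge0 => t _; rewrite mulr_ge0// ltW.
have tangent m : 0 <= m -> p * (S * m `^ (p - 1)) <= B + (p - 1) * (C * m `^ p).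
  move=> m0; rewrite /S mulr_suml mulr_sumr.
  have m0p := powR_ge0 m p.
  apply: (@le_trans _ _ (B + (p - 1) * ((\sum_(t <- s) al t * u t) * m `^ p))).
    rewrite mulr_suml mulr_sumr -big_split /=; apply: ler_sum => t _.
    have h0 : 0 <= g t / u t by rewrite divr_ge0// ltW.
    have au : 0 <= al t * u t by rewrite mulr_ge0// ltW.
    have := ler_wpM2l au (powR_tangent p1 h0 m0).
    rewrite (_ : al t * u t * (p * _) = p * (al t * g t * m `^ (p - 1))); last first.
      by field; rewrite gt_eqF.
    by move=> /le_trans; apply; rewrite le_eqVlt; apply/orP; left; apply/eqP; ring.
  by rewrite lerD2l ler_wpM2l ?(ltW p10)// ler_wpM2r.
move: C0; rewrite le_eqVlt => /predU1P[C0|C0].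
  suff -> : S = 0 by rewrite powR0 ?gt_eqF// mulr_ge0// powR_ge0.
  apply/eqP; rewrite eq_le S0 andbT leNgt; apply/negP => Sgt0.
  (* For C = 0 the tangent inequality says p S m ^ (p - 1) <= B for all m; the
     chosen m makes the left side p (B + 1). *)
  have m0 : 0 <= ((B + 1) / S) `^ (p - 1)^-1 by exact: powR_ge0.
  have := tangent _ m0; rewrite -C0 mul0r mulr0 addr0 -powRrM mulVf ?gt_eqF//.
  rewrite powRr1 ?divr_ge0 ?addr_ge0// mulrC [S * _]mulrC divfK ?gt_eqF//.
  move=> Bp; have : B + 1 <= (B + 1) * p by rewrite ler_peMr ?addr_ge0// ltW.
  by move=> /le_trans /(_ Bp); rewrite gerDl ler10.
(* The tangent point is the weighted mean itself. *)
have m0 : 0 <= S / C by rewrite divr_ge0// ltW.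
have := tangent _ m0; rewrite (_ : (S / C) `^ p = (S / C) * (S / C) `^ (p - 1)); last first.
  by rewrite mulr_powRB1.
rewrite (_ : C * (_ * _) = S * (S / C) `^ (p - 1)); last first.
  by field; rewrite gt_eqF.
rewrite -lerBlDr -mulrBl opprB addrC subrK mul1r => H.
have -> : S `^ p = C `^ (p - 1) * (S * (S / C) `^ (p - 1)).
  rewrite mulrCA -powRM ?(ltW C0)// [C * _]mulrC divfK ?gt_eqF//.
  by rewrite mulr_powRB1.
by rewrite ler_wpM2l ?powR_ge0.
Qed.

(** * Unordered sums and integrals over countable trees *)

Section unordered_sums.
Local Open Scope ereal_scope.

Lemma esum_ge_seq (R : realType) (T : choiceType) (s : seq T) (a : T -> \bar R) :
  uniq s -> \sum_(t <- s) a t <= \esum_(t in [set: T]) a t.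
Proof.
move=> us; apply: esum_ge; exists [set` s]; first by split.
by rewrite fsbig_seq.
Qed.

Lemma esum_le_seq (R : realType) (T : choiceType) (S : set T) (s : seq T)
    (a : T -> \bar R) : (forall t, 0 <= a t) -> S `<=` [set` s] ->
  \esum_(t in S) a t <= \sum_(t <- s) a t.
Proof.
move=> a0 Ss; apply: (@le_trans _ _ (\sum_(t <- undup s) a t)).
  rewrite fsbig_seq ?undup_uniq//; apply: ge_ereal_sup => _ [X [finX XS] <-].
  apply: lee_fsum_nneg_subset => //.
  by move=> x /[!inE] /XS/Ss/=; rewrite mem_undup.
elim: s {Ss} => // x s IH; rewrite [in leRHS]big_cons /=; case: ifP => _.
  by apply: le_trans IH _; rewrite leeDr.
by rewrite big_cons leeD2l.
Qed.

Lemma esum_pair (R : realType) (T1 T2 : choiceType) (a : T1 * T2 -> \bar R) :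
  (forall t, 0 <= a t) ->
  \esum_(t in [set: T1 * T2]) a t =
  \esum_(i in [set: T1]) \esum_(j in [set: T2]) a (i, j).
Proof.
move=> a0; rewrite esum_esum; last by move=> *; exact: a0.
rewrite (_ : _ `*`` _ = setT); last by apply/seteqP; split.
by apply: eq_esum => -[].
Qed.

Lemma esum_exchange (R : realType) (T1 T2 : choiceType) (a : T1 -> T2 -> \bar R) :
  (forall i j, 0 <= a i j) ->
  \esum_(i in [set: T1]) \esum_(j in [set: T2]) a i j =
  \esum_(j in [set: T2]) \esum_(i in [set: T1]) a i j.
Proof.
move=> a0.
rewrite -(esum_pair (a := fun t => a t.1 t.2))//.
rewrite -(esum_pair (a := fun t => a t.2 t.1))//.
rewrite (@reindex_esum _ _ _ [set: T2 * T1] _ (fun t => (t.2, t.1)))//.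
split=> //; first by move=> [? ?] [? ?] _ _ [-> ->].
by move=> [i j] _; exists (j, i).
Qed.

Lemma esumZ_le (R : realType) (T : choiceType) (S : set T) (a : T -> \bar R) (c : R) :
  (0 <= c)%R -> (forall t, 0 <= a t) ->
  \esum_(t in S) (c%:E * a t) <= c%:E * \esum_(t in S) a t.
Proof.
move=> c0 a0; apply: ge_ereal_sup => _ [X [finX XS] <-].
rewrite fsbig_finite//= -ge0_sume_distrr; last by move=> *; exact: a0.
apply: lee_wpmul2l; first by rewrite lee_fin.
by apply: esum_ge; exists X; [split|rewrite fsbig_finite].
Qed.

Lemma esum_geometric_le (R : realType) (A x : R) : (0 <= A)%R -> (0 <= x < 1)%R ->
  \esum_(i in [set: nat]) (A * x ^+ i)%:E <= (A / (1 - x))%:E.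
Proof.
move=> A0 /andP[x0 x1].
have a0 i : (0 <= A * x ^+ i)%R by rewrite mulr_ge0// exprn_ge0.
rewrite -nneseries_esumT; last by move=> i; rewrite lee_fin; exact: a0.
apply: lime_le.
  by apply: is_cvg_nneseries => i _ _; rewrite lee_fin; exact: a0.
apply: nearW => n; rewrite sumEFin lee_fin -mulr_sumr ler_wpM2l//.
by rewrite /index_iota subn0 geometric_sum_le// x0.
Qed.

Lemma esum_le_supp (R : realType) (T : choiceType) (s : seq T) (a : T -> \bar R) :
  (forall t, 0 <= a t)%E -> (forall t, t \notin s -> a t = 0%E) ->
  (\esum_(t in [set: T]) a t <= \sum_(t <- s) a t)%E.
Proof.
move=> a0 as0; apply: le_trans (@esum_le_seq _ _ [set` s] s a a0 _) => //.
rewrite [leRHS]esum_mkcond.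
by apply: le_esum => t _; case: ifPn => //; rewrite notin_setE => /negP /as0 ->.
Qed.

End unordered_sums.

Section counting_measure_on_trees.
Local Open Scope ereal_scope.
Variables (R : realType) (T : tree).
Hypothesis countT : countable [set: T].

Lemma measurable_tree (A : set T) : measurable A.
Proof. by []. Qed.

Lemma measurable_fun_tree d (U : sigmaRingType d) (D : set T) (g : T -> U) :
  measurable_fun D g.
Proof. by move=> mD A mA; exact: measurable_tree. Qed.

Lemma tmeasure1 (x : T) : tmeasure T R [set x] = 1.
Proof.
by rewrite /tmeasure /= /counting asboolT ?fset_set1 ?cardfs1//; exact: finite_set1.
Qed.

(** Countability lets the integral be split along the points of D by countable
    additivity; from here on every integral is an unordered sum, for which Tonelli's
    theorem is [esum_exchange]. *)
Lemma integral_tmeasure (D : set T) (g : T -> \bar R) : (forall x, 0 <= g x) ->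
  \int[tmeasure T R]_(x in D) g x = \esum_(x in D) g x.
Proof.
move=> g0; have /countable_injP[f finj] := countT.
pose F n := D `&` f @^-1` [set n].
have FD : D = \bigcup_n F n.
  apply/seteqP; split=> x; first by move=> Dx; exists (f x).
  by case=> n _ [].
have tF : trivIset setT F by move=> i j _ _ [x [[_ /= <-] [_ /= <-]]].
have mF n : measurable (F n) := measurable_tree (F n).
have mg : measurable_fun (\bigcup_n F n) g by exact: measurable_fun_tree.
rewrite FD (ge0_integral_bigcup (tmeasure T R) mF mg)//.
rewrite esum_bigcupT// nneseries_esumT; last first.
  by move=> n; apply: integral_ge0 => *; exact: g0.
apply: eq_esum => n _; have [[x Fx]|F0] := pselect (exists x, F n x); last first.
  rewrite (_ : F n = set0) ?integral_set0 ?esum_set0//.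
  by apply/seteqP; split=> // x Fx; apply: F0; exists x.
rewrite (_ : F n = [set x]); last first.
  apply/seteqP; split=> [y Fy|_ ->//].
  by apply: finj; rewrite ?inE//; case: Fx => _ ->; case: Fy.
rewrite (eq_integral (cst (g x))); last by move=> y /[!inE] ->.
rewrite esum_set1// integral_cst; last exact: measurable_tree.
by rewrite tmeasure1 mule1.
Qed.

End counting_measure_on_trees.

(** * The tree of a sequence of degrees *)

Lemma card_fset_set_seq (T : choiceType) (s : seq T) :
  #|` fset_set [set` s]%classic | = size (undup s).
Proof.
rewrite -card_fseq; congr (#|` _ |); rewrite -[RHS]set_fsetK; congr fset_set.
by apply/seteqP; split=> x /=; rewrite inE.
Qed.

(** A site (d, n) is the n-th vertex of level d; levels increase downwards and are
    unbounded in both directions. *)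
Definition site : Type := (int * nat)%type.
HB.instance Definition _ := Countable.on site.
HB.instance Definition _ := isPointed.Build site (0, 0%N).

Section horocyclic_tree.
Variable k : int -> nat.
Hypothesis k_ge2 : forall d, (2 <= k d)%N.
Implicit Types (x y z : site) (d : int) (i j r : nat).

(** The children of (d - 1, m) are the k d sites (d, m * k d + c) with c < k d, so
    that ancestors are quotients and sets of descendants are intervals of indices. *)
Definition parent x : site := (x.1 - 1, (x.2 %/ k x.1)%N).

(** The number of descendants at level d of a site lying j levels above. *)
Definition breadth d j : nat := \prod_(l < j) k (d - l%:Z).

Lemma breadth0 d : breadth d 0 = 1%N.
Proof. by rewrite /breadth big_ord0. Qed.

Lemma breadthS d j : breadth d j.+1 = (k d * breadth (d - 1) j)%N.
Proof.
rewrite /breadth big_ord_recl subr0; congr (_ * _)%N.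
by apply: eq_bigr => l _; rewrite /= /bump /=; congr k; lia.
Qed.

Lemma breadthD d i j : breadth d (i + j) = (breadth d i * breadth (d - i%:Z) j)%N.
Proof.
elim: i d => [|i IH] d; first by rewrite breadth0 mul1n subr0.
by rewrite addSn !breadthS IH mulnA; congr (_ * breadth _ _)%N; lia.
Qed.

Lemma breadth_gt0 d j : (0 < breadth d j)%N.
Proof. by apply: prodn_gt0 => l; apply: ltn_trans (k_ge2 _). Qed.

Lemma ltn_breadth d j : (j < breadth d j)%N.
Proof.
elim: j d => [|j IH] d; first by rewrite breadth0.
by rewrite breadthS; have := IH (d - 1); have := k_ge2 d; nia.
Qed.

Lemma iter_parent j x : iter j parent x = (x.1 - j%:Z, (x.2 %/ breadth x.1 j)%N).
Proof.
elim: j x => [|j IH] [d n]; first by rewrite breadth0 divn1 subr0.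
rewrite iterSr IH /parent /= breadthS divnMA; congr (_, _); lia.
Qed.

Definition descendants j z : seq site :=
  [seq (z.1 + j%:Z, (z.2 * breadth (z.1 + j%:Z) j + c)%N)
     | c <- iota 0 (breadth (z.1 + j%:Z) j)].

Lemma size_descendants j z : size (descendants j z) = breadth (z.1 + j%:Z) j.
Proof. by rewrite size_map size_iota. Qed.

Lemma uniq_descendants j z : uniq (descendants j z).
Proof. by rewrite map_inj_uniq ?iota_uniq// => c c' [] /addnI. Qed.

Lemma mem_descendants j y z : (y \in descendants j z) = (iter j parent y == z).
Proof.
case: z => d m; rewrite iter_parent; apply/mapP/eqP => [[c]|].
  rewrite mem_iota /= add0n => cB ->/=; congr (_, _); first lia.
  by rewrite divnMDl ?breadth_gt0// divn_small ?addn0.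
case: y => e n /= [<- <-]; rewrite subrK.
exists (n %% breadth e j)%N; last by rewrite -divn_eq.
by rewrite mem_iota /= ltn_pmod ?breadth_gt0.
Qed.

Definition horo_adj : rel site := fun x y => (parent x == y) || (parent y == x).

Lemma horo_adj_sym : symmetric horo_adj.
Proof. by move=> x y; rewrite /horo_adj orbC. Qed.

Lemma parent_neq x : parent x != x.
Proof. by apply/eqP => /(congr1 fst) /=; lia. Qed.

Lemma horo_adj_irr : irreflexive horo_adj.
Proof. by move=> x; rewrite /horo_adj orbb (negbTE (parent_neq x)). Qed.

(** Indices shrink at least by half with each generation, hence vanish eventually:
    two sites on a common level merge in some site (d, 0). *)
Lemma common_ancestor x y : exists i j, iter i parent x = iter j parent y.
Proof.
wlog xy : x y / y.1 <= x.1.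
  move=> H; case/orP: (le_total y.1 x.1) => [/H//|/H[i [j ij]]].
  by exists j, i.
pose N := (x.2 + y.2)%N; exists (N + `|x.1 - y.1|)%N, N.
rewrite !iter_parent; congr (_, _); first lia.
by rewrite !divn_small //; apply: leq_ltn_trans (ltn_breadth _ _); lia.
Qed.

Lemma path_to_ancestor x i :
  exists c, [/\ path horo_adj x c, last x c = iter i parent x & size c = i].
Proof.
exists (traject parent (parent x) i); rewrite last_traject size_traject; split=> //.
elim: i x => //= i IH x; rewrite IH andbT; exact/orP/or_introl/eqP.
Qed.

Lemma path_through_ancestor x y i j : iter i parent x = iter j parent y ->
  exists c, [/\ path horo_adj x c, last x c = y & size c = (i + j)%N].
Proof.
move=> xy; have [c [xc cl cs]] := path_to_ancestor x i.
have [c' [yc' c'l c's]] := path_to_ancestor y j.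
exists (c ++ rev (belast y c')); split.
- rewrite cat_path xc cl xy -c'l rev_path /=.
  by rewrite (eq_path (e' := horo_adj))// => u v; exact: horo_adj_sym.
- rewrite last_cat cl xy -c'l; case: c' {yc' c'l c's} => [//|v c'] /=.
  by rewrite rev_cons last_rcons.
- by rewrite size_cat cs size_rev size_belast c's.
Qed.

Lemma horo_connected x y : exists c, path horo_adj x c /\ last x c = y.
Proof.
have [i [j /path_through_ancestor[c [? ? _]]]] := common_ancestor x y.
by exists c.
Qed.

Lemma lowest_site (s : seq site) : s != [::] ->
  exists2 x, x \in s & {in s, forall y, y.1 <= x.1}.
Proof.
elim: s => // x [_ _|y s /(_ isT)[z zs zmax] _].
  by exists x => [|u]; rewrite mem_seq1// => /eqP ->.
have [xz|/ltW zx] := leP x.1 z.1.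
  exists z; first by rewrite inE zs orbT.
  by move=> u; rewrite inE => /predU1P[->//|/zmax].
exists x; first by rewrite mem_head.
by move=> u; rewrite inE => /predU1P[->//|/zmax/le_trans]; apply.
Qed.

(** The two neighbours on a cycle of one of its lowest sites would both be the
    parent of that site. *)
Lemma horo_acyclic (c : seq site) : ucycle horo_adj c -> (size c <= 2)%N.
Proof.
move=> /andP[cc uc]; rewrite leqNgt; apply/negP => c3.
have [|x xc xmax] := @lowest_site c; first by case: (c) c3.
have up y : y \in c -> horo_adj x y -> y = parent x.
  move=> /xmax yx /orP[/eqP//|/eqP xE]; move: yx; rewrite -xE /=; lia.
have [n p cE] := rot_to xc.
have mem_c : c =i x :: p by move=> z; rewrite -cE mem_rot.
move: cc uc c3; rewrite -(rot_cycle n) -(rot_uniq n) -(size_rot n) cE.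
case: p mem_c {cE} => [|y p mem_c] //; case/lastP: p mem_c => [|p z mem_c] //.
rewrite /= rcons_path last_rcons => /and3P[xy _ zx] /andP[_ /andP[+ _]] _.
have yE : y = parent x by apply: (up _ _ xy); rewrite mem_c in_cons mem_head orbT.
have zE : z = parent x.
  apply: up; last by rewrite horo_adj_sym.
  by rewrite mem_c in_cons in_cons mem_rcons mem_head !orbT.
by rewrite mem_rcons yE zE mem_head.
Qed.

Definition horo_tree : tree :=
  Tree horo_adj_sym horo_adj_irr horo_connected horo_acyclic.

Lemma common_ancestor_path x c : path horo_adj x c ->
  exists i j, (i + j <= size c)%N /\ iter i parent x = iter j parent (last x c).
Proof.
elim/last_ind: c => [|c y IH]; first by exists 0%N, 0%N.
rewrite rcons_path last_rcons size_rcons => /andP[/IH[i [j [ij xE]]]].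
move=> /orP[] /eqP; last first.
  by move=> yE; exists i, j.+1; rewrite iterSr yE addnS ltnS.
case: j ij xE => [|j] ij xE yE.
  exists i.+1, 0%N; rewrite iterS xE yE; split=> //; lia.
exists i, j; rewrite xE iterSr yE; split=> //; lia.
Qed.

(** A path can be shortened to one that first climbs and then descends, because a
    step down followed by a step up returns to the same site. *)
Lemma tballE (x : horo_tree) r :
  tball x r = [set y : horo_tree | exists i j,
    (i + j <= r)%N /\ iter i parent x = iter j parent y]%classic.
Proof.
apply/seteqP; split => y; rewrite /tball /tdist /=.
  case: ex_minnP => m /asboolP[c [xc <- <-]] _ mr.
  have [i [j [ij xy]]] := common_ancestor_path xc.
  by exists i, j; split=> //; exact: leq_trans ij mr.
move=> [i [j [ij /path_through_ancestor xy]]].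
case: ex_minnP => m _ mmin; apply: leq_trans (ij); apply: mmin; exact/asboolP.
Qed.

Lemma nu_horo (x : horo_tree) : nu x = (k (x.1 + 1)).+1.
Proof.
pose s := parent x :: descendants 1 (x : site).
have us : uniq s.
  rewrite /= uniq_descendants andbT mem_descendants /=.
  by apply/eqP => /(congr1 fst) /=; lia.
rewrite /nu; transitivity (size s); last first.
  by rewrite /= size_descendants breadthS breadth0 muln1.
rewrite (_ : mkset _ = [set` s])%classic; last first.
  apply/seteqP; split=> y /=; rewrite inE mem_descendants /adj /= /horo_adj;
    by rewrite [y == _]eq_sym.
by rewrite card_fset_set_seq undup_id.
Qed.

End horocyclic_tree.

(** * Balls and averages *)

Section balls.
Variable k : int -> nat.
Hypothesis k_ge2 : forall d, (2 <= k d)%N.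
Let T := horo_tree k_ge2.
Implicit Types (x y : T) (i j r : nat).

Lemma countable_horo : countable [set: T].
Proof. exact: (@countableP site). Qed.

Lemma site_level (x : site) i : (iter i (parent k) x).1 = x.1 - i%:Z.
Proof. by rewrite iter_parent. Qed.

(** A site z occurs once for every ancestor that it shares with x and through which
    it is reached in at most r steps; upper bounds can afford the overcounting, and
    z need not be assigned to its nearest common ancestor with x. *)
Definition meetings r (x : site) : seq (site * (nat * nat)) :=
  [seq (z, t) | t <- [seq (i, j) | i <- iota 0 r.+1, j <- iota 0 (r - i).+1],
                z <- descendants k t.2 (iter t.1 (parent k) x)].

Lemma mem_meetings r (x : site) t : (t \in meetings r x) =
  (t.2.1 + t.2.2 <= r)%N && (iter t.2.1 (parent k) x == iter t.2.2 (parent k) t.1).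
Proof.
case: t => y [i j]; apply/idP/andP => /=.
  move=> /allpairsPdep[[i' j'] [y' [/allpairsPdep[i1 [j1 [+ + [-> ->]]]] + [-> -> ->]]]] /=.
  rewrite !mem_iota mem_descendants// eq_sym => ? ? ->; split=> //; lia.
move=> [ij xy]; apply/allpairsPdep; exists (i, j), y; split=> //; last first.
  by rewrite mem_descendants// eq_sym.
by apply/allpairsPdep; exists i, j; rewrite !mem_iota; split=> //; lia.
Qed.

Lemma uniq_meetings r (x : site) : uniq (meetings r x).
Proof.
apply: allpairs_uniq_dep.
- apply: allpairs_uniq_dep => [||[? ?] [? ?] _ _ [-> ->]//]; first exact: iota_uniq.
  by move=> i _; exact: iota_uniq.
- by move=> t _; exact: uniq_descendants.
- by move=> [t y] [t' y'] _ _ /= [-> ->].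
Qed.

Lemma tball_meetings x r : tball x r `<=` [set` [seq t.1 | t <- meetings r x]].
Proof.
move=> y; rewrite tballE => -[i [j [ij xy]]].
apply/mapP; exists ((y : site), (i, j)) => //.
by rewrite mem_meetings ij; exact/eqP.
Qed.

Lemma finite_tball x r : finite_set (tball x r).
Proof. by apply: (sub_finite_set (@tball_meetings x r)); exact: finite_seq. Qed.

Lemma tmeasure_tball (R : realType) x r :
  fine (tmeasure T R (tball x r)) = (#|` fset_set (tball x r)|)%:R.
Proof. by rewrite /tmeasure /= /counting asboolT//; exact: finite_tball. Qed.

Lemma leq_card_tball x r : (breadth k ((x : site).1 + r%:Z) r <= #|` fset_set (tball x r)|)%N.
Proof.
rewrite -size_descendants -(undup_id (uniq_descendants k r x)) -card_fset_set_seq.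
apply: fsubset_leq_card.
rewrite -fset_set_sub; [|exact: finite_seq|exact: finite_tball].
move=> y /=; rewrite mem_descendants// => /eqP yx; rewrite tballE.
by exists 0%N, r; rewrite yx.
Qed.

Lemma leq_breadth d m r : (m <= r)%N ->
  (breadth k (d + m%:Z) m <= breadth k (d + r%:Z) r)%N.
Proof.
move=> mr; have [e ->] : exists e, r = (e + m)%N by exists (r - m)%N; rewrite subnK.
rewrite breadthD (_ : d + (e + m)%N%:Z - e%:Z = d + m%:Z); last by lia.
by rewrite leq_pmull// breadth_gt0.
Qed.

Lemma sumr_meetings (R : realType) r (x : site) (F : nat -> nat -> R) :
  \sum_(t <- meetings r x) F t.2.1 t.2.2 =
  \sum_(i <- iota 0 r.+1) \sum_(j <- iota 0 (r - i).+1)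
     (breadth k (x.1 - i%:Z + j%:Z) j)%:R * F i j.
Proof.
rewrite big_allpairs_dep big_allpairs_dep/=; apply: eq_bigr => i _.
apply: eq_bigr => j _; rewrite big_const_seq count_predT size_descendants.
by rewrite site_level iter_addr_0 mulr_natl.
Qed.

(** The averages whose supremum over r is the maximal function. *)
Definition tmean (R : realType) (f : T -> R) (x : T) r : \bar R :=
  ((fine (tmeasure T R (tball x r)))^-1%:E *
   \int[tmeasure T R]_(y in tball x r) `|f y|%:E)%E.

Lemma tmean_ge0 (R : realType) (f : T -> R) x r : (0 <= tmean f x r)%E.
Proof.
apply: mule_ge0; first by rewrite lee_fin invr_ge0; exact: fine_ge0.
by apply: integral_ge0 => *; rewrite lee_fin.
Qed.

Lemma tmaximal_ge0 (R : realType) (f : T -> R) x : (0 <= tmaximal f x)%E.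
Proof.
by apply: le_trans (tmean_ge0 f x 0) (ereal_sup_ubound _); exists 0%N.
Qed.

(** To make the kernel independent of r, a site met after i + j <= r steps is weighted
    by the inverse of the number of descendants of x in generation i + j: these all
    lie in the ball of radius i + j, hence they are at most as many as the points of
    the ball of radius r. *)
Lemma tmean_le (R : realType) (f : T -> R) x r :
  (tmean f x r <= (\sum_(t <- meetings r x)
     ((breadth k ((x : site).1 + (t.2.1 + t.2.2)%:Z) (t.2.1 + t.2.2))%:R)^-1 *
       `|f t.1|)%:E)%E.
Proof.
rewrite /tmean integral_tmeasure; last 2 first.
- exact: countable_horo.
- by move=> y; rewrite lee_fin.
have cge0 : (0 < #|` fset_set (tball x r)|)%N.
  exact: leq_trans (breadth_gt0 k_ge2 _ _) (leq_card_tball x r).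
apply: (@le_trans _ _ (((fine (tmeasure T R (tball x r)))^-1)%:E *
    \sum_(y <- [seq t.1 | t <- meetings r x]) `|f y|%:E)%E).
  apply: lee_wpmul2l; first by rewrite tmeasure_tball lee_fin invr_ge0.
  by apply: esum_le_seq (@tball_meetings x r) => y; rewrite lee_fin.
rewrite big_map sumEFin -EFinM lee_fin mulr_sumr tmeasure_tball.
rewrite big_seq [leRHS]big_seq; apply: ler_sum => t.
rewrite mem_meetings => /andP[tr _]; rewrite ler_wpM2r//.
rewrite lef_pV2 ?posrE ?ltr0n ?breadth_gt0// ler_nat.
exact: leq_trans (leq_breadth _ tr) (leq_card_tball x r).
Qed.

End balls.

(** * Sizes of generations *)

Section breadth_bounds.
Variables (k : int -> nat) (a : nat).
Hypotheses (k_ge2 : forall d, (2 <= k d)%N) (a_gt0 : (0 < a)%N)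
  (k_gea : forall d, (a <= k d)%N).
Variables (R : realType) (C gam : R).
Hypotheses (gam_gt0 : 0 < gam)
  (breadth_le : forall d j, (breadth k d j)%:R <= C * gam ^+ j).
Implicit Types (d : int) (i j r : nat).

Let b0 d j : (0 : R) < (breadth k d j)%:R.
Proof. by rewrite ltr0n breadth_gt0. Qed.

Let ar0 : (0 : R) < a%:R. Proof. by rewrite ltr0n. Qed.

Lemma breadth_const_ge1 : 1 <= C.
Proof. by have := breadth_le 0 0; rewrite breadth0 expr0 mulr1. Qed.

Lemma breadth_ge d j : (a%:R ^+ j : R) <= (breadth k d j)%:R.
Proof.
elim: j d => [|j IH] d; first by rewrite breadth0.
by rewrite breadthS exprS natrM ler_pM ?exprn_ge0// ler_nat.
Qed.

(** The first factor counts the sites that meet x, of level d, in the ancestor i steps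
    above x, j steps above them; the last factor on the right is a lower bound for
    the size of the ball of radius i + j around x. For i <= j the two products of degrees share
    the levels d + 1, ..., d + j - i; what remains is i levels on the left, at most
    C * gam ^ i, against 2 * i levels on the right, at least a ^ (2 * i). For i > j
    bounding the two products separately is enough. *)
Lemma breadth_ratio d i j :
  (breadth k (d - i%:Z + j%:Z) j)%:R * a%:R ^+ (i - j) <=
  C * (gam / a%:R ^+ 2) ^+ minn i j * (breadth k (d + (i + j)%:Z) (i + j))%:R.
Proof.
have [ij|/ltnW ji] := leqP i j.
  have [e je] : exists e, j = (i + e)%N by exists (j - i)%N; lia.
  rewrite (_ : (i - j)%N = 0%N); last by lia.
  rewrite expr0 mulr1 je {j ij je}.
  rewrite (_ : d - i%:Z + (i + e)%:Z = d + e%:Z); last by lia.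
  rewrite [in X in X <= _](addnC i e) breadthD (_ : d + e%:Z - e%:Z = d); last by lia.
  rewrite (_ : (i + (i + e))%N = (2 * i + e)%N); last by lia.
  rewrite breadthD (_ : d + (2 * i + e)%:Z - (2 * i)%:Z = d + e%:Z); last by lia.
  rewrite !natrM [X in X <= _]mulrC mulrA ler_wpM2r ?ler0n//.
  apply: le_trans (breadth_le _ _) _.
  rewrite -mulrA ler_wpM2l ?(le_trans _ breadth_const_ge1)// expr_div_n -exprM mulrAC.
  rewrite ler_pdivlMr ?exprn_gt0// ler_wpM2l ?exprn_ge0 ?(ltW gam_gt0)//.
  exact: breadth_ge.
have [e ie] : exists e, i = (j + e)%N by exists (i - j)%N; lia.
rewrite (_ : (i - j)%N = e); last by lia.
apply: (@le_trans _ _ (C * gam ^+ j * a%:R ^+ e)).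
  by rewrite ler_wpM2r ?exprn_ge0// ltW.
rewrite -!mulrA ler_wpM2l ?(le_trans _ breadth_const_ge1)// expr_div_n -exprM -mulrA.
rewrite ler_wpM2l ?exprn_ge0 ?(ltW gam_gt0)// mulrC ler_pdivlMr ?exprn_gt0//.
rewrite -exprD (_ : (e + 2 * j)%N = (i + j)%N); last by lia.
exact: breadth_ge.
Qed.

(** The row sums of the Schur test. The number sig < 1 is a common ratio of geometric
    decay in i and in j: the hypothesis on gam gives the decay along the diagonal
    i = j, and those on v give it on the two sides of the diagonal. *)
Lemma breadth_weight_down (v sig : R) d i j :
  0 < v -> 0 <= sig -> gam / a%:R ^+ 2 <= sig ^+ 2 -> v / a%:R <= sig -> v^-1 <= sig ->
  (breadth k (d - i%:Z + j%:Z) j)%:R * (v ^+ i / v ^+ j) <=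
  C * sig ^+ (i + j) * (breadth k (d + (i + j)%:Z) (i + j))%:R.
Proof.
move=> v0 s0 ths vas vs; have th0 : 0 <= gam / a%:R ^+ 2.
  by rewrite divr_ge0 ?exprn_ge0// ltW.
have C0 : 0 <= C by apply: le_trans breadth_const_ge1.
have := breadth_ratio d i j.
set B := (breadth _ _ j)%:R; set D := (breadth _ _ (i + j))%:R.
have D0 : 0 <= D by rewrite ler0n.
have [ij|/ltnW ji] := leqP i j.
  have [e je] : exists e, j = (i + e)%N by exists (j - i)%N; rewrite subnKC.
  have -> : (i - j)%N = 0%N by apply/eqP; rewrite subn_eq0.
  rewrite expr0 mulr1.
  have -> : v ^+ i / v ^+ j = v^-1 ^+ e.
    rewrite je exprD exprVn; field.
    by rewrite !gt_eqF ?exprn_gt0.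
  have vi0 : 0 <= v^-1 by rewrite invr_ge0 ltW.
  move=> H; apply: le_trans (ler_wpM2r (exprn_ge0 e vi0) H) _.
  rewrite mulrAC ler_wpM2r// -mulrA ler_wpM2l//.
  rewrite je addnA addnn -mul2n exprD exprM.
  apply: ler_pM; rewrite ?exprn_ge0//; apply: lerXn2r; rewrite // nnegrE.
  exact: exprn_ge0.
have [e ie] : exists e, i = (j + e)%N by exists (i - j)%N; rewrite subnKC.
have -> : (i - j)%N = e by rewrite ie addKn.
move=> H; have -> : B * (v ^+ i / v ^+ j) = B * a%:R ^+ e * (v / a%:R) ^+ e.
  rewrite ie exprD expr_div_n; field.
  by rewrite !gt_eqF ?exprn_gt0.
have va0 : 0 <= v / a%:R by rewrite divr_ge0// ltW.
apply: le_trans (ler_wpM2r (exprn_ge0 e va0) H) _.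
rewrite mulrAC ler_wpM2r// -mulrA ler_wpM2l//.
rewrite ie addnAC addnn -mul2n exprD exprM.
apply: ler_pM; rewrite ?exprn_ge0//; apply: lerXn2r; rewrite // nnegrE.
exact: exprn_ge0.
Qed.

(** The column sums of the Schur test: a site meets only breadth d i <= C * gam ^ i
    sites of level d in a given ancestor, which the ball size a ^ (i + j) and the
    weight compensate. *)
Lemma breadth_weight_up (w sig : R) d i j :
  0 < w -> 0 <= sig -> gam / (a%:R * w) <= sig -> w / a%:R <= sig ->
  (breadth k d i)%:R * ((w ^+ j / w ^+ i) / (breadth k (d + (i + j)%:Z) (i + j))%:R)
    <= C * sig ^+ i * sig ^+ j.
Proof.
move=> w0 s0 gs ws; have C0 : 0 <= C by apply: le_trans breadth_const_ge1.
apply: (@le_trans _ _ (C * gam ^+ i * ((w ^+ j / w ^+ i) / a%:R ^+ (i + j)))).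
  apply: ler_pM => //; first by rewrite !divr_ge0 ?exprn_ge0 ?(ltW w0)// ltW.
  rewrite ler_wpM2l ?divr_ge0 ?exprn_ge0 ?(ltW w0)// lef_pV2 ?posrE ?exprn_gt0//.
  exact: breadth_ge.
have -> : C * gam ^+ i * ((w ^+ j / w ^+ i) / a%:R ^+ (i + j)) =
    C * (gam / (a%:R * w)) ^+ i * (w / a%:R) ^+ j.
  by rewrite !expr_div_n exprMn exprD; field; rewrite !gt_eqF ?exprn_gt0.
have g0 : 0 <= gam / (a%:R * w) by rewrite divr_ge0 ?mulr_ge0 ?(ltW w0)// ltW.
have wa0 : 0 <= w / a%:R by rewrite divr_ge0 ?(ltW w0).
apply: ler_pM; rewrite ?mulr_ge0 ?exprn_ge0// ?ler_wpM2l//; exact: lerXn2r.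
Qed.

End breadth_bounds.

(** * Boundedness above the growth rate *)

(** The Schur test needs v in the interval (1, a) with w = v ^ (p - 1) in
    (gam / a, a). In terms of w this means max (1, gam / a) < w < min (a, a ^ (p - 1)),
    which is solvable because gam < a ^ 2 and gam < a ^ p. *)
Lemma schur_parameters (R : realType) (a gam p : R) :
  1 < a -> 0 < gam -> 1 < p -> gam < a ^+ 2 -> gam < a `^ p ->
  exists v w sig : R, [/\ 0 < v, w = v `^ (p - 1), 0 <= sig < 1,
    [/\ gam / a ^+ 2 <= sig ^+ 2, v / a <= sig & v^-1 <= sig] &
    gam / (a * w) <= sig /\ w / a <= sig].
Proof.
move=> a1 g0 p1 ga gap; have a0 : 0 < a by apply: lt_trans a1.
have p10 : 0 < p - 1 by rewrite subr_gt0.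
have ap1 : 1 < a `^ (p - 1).
  by rewrite -[ltLHS](powRr0 a); exact: ltr_powR2l.
have gaa : gam / a < a by rewrite ltr_pdivrMr// -expr2.
have gap1 : gam / a < a `^ (p - 1).
  by rewrite ltr_pdivrMr// mulrC mulr_powRB1 ?ltW// (lt_trans _ p1).
pose lo := Num.max 1 (gam / a); pose hi := Num.min a (a `^ (p - 1)).
have lohi : lo < hi by rewrite /lo /hi gt_max !lt_min a1 ap1 gaa gap1.
pose w := (lo + hi) / 2; have [low whi] := midf_lt lohi.
have {low} [w1 gw] : 1 < w /\ gam / a < w by apply/andP; rewrite -gt_max.
have {whi} [wa wap] : w < a /\ w < a `^ (p - 1) by apply/andP; rewrite -lt_min.
have w0 : 0 < w by apply: lt_trans w1.
pose v := w `^ (p - 1)^-1.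
have v0 : 0 < v by rewrite powR_gt0.
have wE : w = v `^ (p - 1) by rewrite -powRrM mulVf ?gt_eqF// powRr1 ?ltW.
have v1 : 1 < v.
  by rewrite -[ltLHS](powRr0 w); apply: ltr_powR2l; rewrite ?invr_gt0.
have va : v < a.
  rewrite -[a](powRr1 (ltW a0)) -(@divff _ (p - 1)) ?gt_eqF// powRrM.
  by rewrite gt0_ltr_powR ?invr_gt0// nnegrE ?powR_ge0 ?ltW.
pose s := [:: Num.sqrt (gam / a ^+ 2); v / a; v^-1; gam / (a * w); w / a].
pose sig := \big[Num.max/0]_(z <- s) z.
have le_sig z : z \in s -> z <= sig by move=> zs; exact: le_bigmax_seq.
have sig0 : 0 <= sig by exact: bigmax_ge_id.
exists v, w, sig; split=> //.
- rewrite sig0 /sig /s !big_cons big_nil !gt_max ltr01 andbT.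
  have -> : Num.sqrt (gam / a ^+ 2) < 1.
    by rewrite -[ltRHS]sqrtr1 ltr_sqrt// ltr_pdivrMr ?exprn_gt0// mul1r.
  have -> : v / a < 1 by rewrite ltr_pdivrMr// mul1r.
  have -> : w / a < 1 by rewrite ltr_pdivrMr// mul1r.
  have -> : gam / (a * w) < 1.
    have aw0 : 0 < a * w by exact: mulr_gt0.
    by rewrite (ltr_pdivrMr _ _ aw0) mul1r mulrC -ltr_pdivrMr.
  by rewrite invf_lt1// v1.
- split; [|by apply: le_sig; rewrite !inE eqxx ?orbT..].
  rewrite -[leLHS]sqr_sqrtr; last by rewrite divr_ge0 ?exprn_ge0 ?ltW.
  by apply: lerXn2r; rewrite ?nnegrE ?sqrtr_ge0// le_sig// mem_head.
- by split; apply: le_sig; rewrite !inE eqxx ?orbT.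
Qed.

Section strong_type.
Variables (k : int -> nat) (a : nat).
Hypotheses (k_ge2 : forall d, (2 <= k d)%N) (a_gt1 : (1 < a)%N)
  (k_gea : forall d, (a <= k d)%N).
Variables (R : realType) (C gam : R).
Hypotheses (gam_gt0 : 0 < gam)
  (breadth_le : forall d j, (breadth k d j)%:R <= C * gam ^+ j).
Let T := horo_tree k_ge2.
Local Notation anc i := (iter i (parent k)).
Let a_gt0 : (0 < a)%N. Proof. exact: ltnW. Qed.

Variables (p v w sig : R).
Hypotheses (p1 : 1 < p) (v0 : 0 < v) (wE : w = v `^ (p - 1)) (sig01 : 0 <= sig < 1)
  (th_sig : gam / a%:R ^+ 2 <= sig ^+ 2) (va_sig : v / a%:R <= sig)
  (vV_sig : v^-1 <= sig) (gw_sig : gam / (a%:R * w) <= sig) (wa_sig : w / a%:R <= sig).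

Let D (x : site) (t : nat * nat) : R :=
  (breadth k (x.1 + (t.1 + t.2)%:Z) (t.1 + t.2))%:R.
Let C1 : R := C / (1 - sig) ^+ 2.

Let D0 x t : 0 < D x t. Proof. by rewrite /D ltr0n breadth_gt0. Qed.
Let w0 : 0 < w. Proof. by rewrite wE powR_gt0. Qed.
Let sig0 : 0 <= sig. Proof. by case/andP: sig01. Qed.
Let sigV0 : 0 < 1 - sig. Proof. by case/andP: sig01; rewrite subr_gt0. Qed.
Let C0 : 0 <= C. Proof. exact: le_trans (breadth_const_ge1 breadth_le). Qed.
Let C10 : 0 <= C1. Proof. by rewrite divr_ge0// exprn_ge0// ltW. Qed.

Lemma schur_down (x : site) r :
  \sum_(t <- meetings k r x) (D x t.2)^-1 * (v ^+ t.2.1 / v ^+ t.2.2) <= C1.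
Proof.
rewrite (sumr_meetings k r x (fun i j => (D x (i, j))^-1 * (v ^+ i / v ^+ j))).
apply: (@le_trans _ _ (\sum_(i <- iota 0 r.+1)
    C * sig ^+ i * \sum_(j <- iota 0 (r - i).+1) sig ^+ j)).
  apply: ler_sum => i _; rewrite mulr_sumr; apply: ler_sum => j _.
  rewrite mulrCA mulrC ler_pdivrMr// -[C * sig ^+ i * sig ^+ j]mulrA -exprD.
  exact: (breadth_weight_down a_gt0 k_gea gam_gt0 breadth_le).
apply: (@le_trans _ _ (\sum_(i <- iota 0 r.+1) C * sig ^+ i * (1 - sig)^-1)).
  apply: ler_sum => i _; rewrite ler_wpM2l ?mulr_ge0 ?exprn_ge0//.
  exact: geometric_sum_le.
rewrite -mulr_suml -mulr_sumr /C1 expr2 invfM mulrA ler_wpM2r ?invr_ge0 ?(ltW sigV0)//.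
by rewrite ler_wpM2l// geometric_sum_le.
Qed.

Variable f : T -> R.

(** The p-th power turns the weight v ^ (i - j) into v ^ ((i - j) * (1 - p)), that is
    w ^ (j - i). *)
Let K (t : site * (nat * nat)) (x : site) : \bar R :=
  if anc t.2.1 x == anc t.2.2 t.1
  then ((w ^+ t.2.2 / w ^+ t.2.1) / D x t.2 * `|f t.1| `^ p)%:E else 0%E.

Let K0 t x : (0 <= K t x)%E.
Proof.
rewrite /K; case: ifP => // _; rewrite lee_fin mulr_ge0 ?powR_ge0//.
by rewrite !divr_ge0 ?exprn_ge0// ltW.
Qed.

Let E (x : site) : \bar R := (\esum_(t in [set: site * (nat * nat)]) K t x)%E.

(** Jensen's inequality with weight u = v ^ (i - j) replaces the p-th power of an
    average by a sum that is linear in the p-th power of f and independent of r. *)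
Lemma tmean_powR_le (x : T) r :
  ((tmean f x r) `^ p <= (C1 `^ (p - 1))%:E * E x)%E.
Proof.
have p0 : 0 < p by apply: lt_trans p1.
pose al (t : site * (nat * nat)) := (D x t.2)^-1.
pose u (t : site * (nat * nat)) := v ^+ t.2.1 / v ^+ t.2.2.
have u0 t : 0 < u t by rewrite divr_gt0 ?exprn_gt0.
pose g (t : site * (nat * nat)) := `|f t.1|.
have al0 t : 0 <= al t by rewrite invr_ge0 ltW.
apply: (@le_trans _ _ ((\sum_(t <- meetings k r x) al t * g t) `^ p)%:E).
  rewrite -poweR_EFin; apply: gt0_ler_poweR; rewrite ?(ltW p0)//.
  - by rewrite in_itv/= leey andbT; exact: tmean_ge0.
  - rewrite in_itv/= leey andbT lee_fin; apply: sumr_ge0 => t _.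
    by apply: mulr_ge0; [exact: al0|exact: normr_ge0].
  - exact: tmean_le.
have /= := @weighted_power_mean R _ (meetings k r x) al u g p C1 p1 al0 u0
  (fun=> normr_ge0 _) (schur_down x r).
rewrite -lee_fin => /le_trans; apply; rewrite EFinM.
apply: lee_wpmul2l; first by rewrite lee_fin powR_ge0.
apply: le_trans (esum_ge_seq (fun t => K t x) (uniq_meetings k r x)).
rewrite -sumEFin big_seq [leRHS]big_seq; apply: lee_sum => t.
rewrite mem_meetings// => /andP[_ xt]; rewrite /K xt lee_fin.
have ui0 : 0 <= (u t)^-1 by rewrite invr_ge0 ltW.
have uE : u t * (u t)^-1 `^ p = w ^+ t.2.2 / w ^+ t.2.1.
  rewrite -mulr_powRB1// mulrA divff ?gt_eqF// mul1r /u invf_div.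
  rewrite powRM ?invr_ge0 ?exprn_ge0 ?(ltW v0)//.
  rewrite -[(v ^+ t.2.1)^-1]powR_inv1 ?exprn_ge0 ?(ltW v0)//.
  rewrite powRAC !powR_exprn ?(ltW v0)// -wE ?(ltW w0)//.
  by rewrite (powR_inv1 (ltW w0)) exprVn.
rewrite powRM//; last exact: normr_ge0.
rewrite (_ : _ * _ = u t * (u t)^-1 `^ p * al t * g t `^ p); last by ring.
by rewrite uE.
Qed.

Lemma schur_up (t : site * (nat * nat)) :
  (\esum_(x in [set: site]) K t x <=
   (C * `|f t.1| `^ p * sig ^+ t.2.1 * sig ^+ t.2.2)%:E)%E.
Proof.
case: t => y [i j].
have supp x : x \notin descendants k i (anc j y) -> K (y, (i, j)) x = 0%E.
  by rewrite mem_descendants// /K /= => /negbTE ->.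
apply: le_trans (esum_le_supp (K0 _) supp) _.
set d := (anc j y).1 + i%:Z.
have fy0 : 0 <= `|f y| `^ p by exact: powR_ge0.
apply: (@le_trans _ _ (\sum_(x <- descendants k i (anc j y))
   ((w ^+ j / w ^+ i) / (breadth k (d + (i + j)%:Z) (i + j))%:R * `|f y| `^ p)%:E)%E).
  rewrite big_seq [leRHS]big_seq; apply: lee_sum => x.
  rewrite mem_descendants// => xy; rewrite /K /= xy /D /=.
  rewrite /d -(eqP xy) site_level subrK//.
rewrite sumEFin big_const_seq count_predT size_descendants -/d iter_addr_0 lee_fin.
rewrite -mulrnAl -[X in X * _]mulr_natl.
rewrite (_ : C * _ * _ * _ = C * sig ^+ i * sig ^+ j * `|f y| `^ p); last by ring.
rewrite ler_wpM2r//.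
exact: (breadth_weight_up k_ge2 a_gt0 k_gea gam_gt0 breadth_le).
Qed.

Lemma esum_schur_up :
  (\esum_(x in [set: site]) E x <=
   C1%:E * \esum_(y in [set: site]) (`|f y| `^ p)%:E)%E.
Proof.
rewrite /E esum_exchange//.
apply: (@le_trans _ _ (\esum_(y in [set: site]) (C1%:E * (`|f y| `^ p)%:E))%E);
  last by apply: esumZ_le => // y; rewrite lee_fin powR_ge0.
apply: le_trans (le_esum (fun t _ => schur_up t)) _.
have c0 y i : 0 <= C * `|f y| `^ p * sig ^+ i.
  by rewrite !mulr_ge0 ?powR_ge0 ?exprn_ge0.
rewrite esum_pair; last by move=> [y [i j]]; rewrite lee_fin mulr_ge0 ?exprn_ge0.
apply: le_esum => y _ /=.
rewrite esum_pair; last by move=> [i j]; rewrite lee_fin mulr_ge0 ?exprn_ge0.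
apply: (@le_trans _ _
    (\esum_(i in [set: nat]) (C * `|f y| `^ p / (1 - sig) * sig ^+ i)%:E)%E).
  by apply: le_esum => i _; rewrite /= (mulrAC (C * `|f y| `^ p)); exact: esum_geometric_le.
apply: le_trans (esum_geometric_le _ sig01) _.
  by rewrite divr_ge0 ?(ltW sigV0)// mulr_ge0 ?powR_ge0.
rewrite -EFinM lee_fin le_eqVlt /C1; apply/orP; left; apply/eqP; field.
by rewrite gt_eqF.
Qed.

(** The bound of [tmean_powR_le] is uniform in r, so it passes to the supremum;
    summing over x and exchanging the sums gives the strong type estimate. *)
Lemma esum_tmaximal_le :
  (\esum_(x in [set: T]) (tmaximal f x) `^ p <=
   (C1 `^ (p - 1) * C1)%:E * \esum_(y in [set: T]) (`|f y| `^ p)%:E)%E.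
Proof.
have p0 : 0 < p by apply: lt_trans p1.
have E0 x : (0 <= E x)%E by exact: esum_ge0.
have c0 : (0 <= (C1 `^ (p - 1))%:E)%E by rewrite lee_fin powR_ge0.
apply: (@le_trans _ _ (\esum_(x in [set: T]) ((C1 `^ (p - 1))%:E * E x))%E); last first.
  apply: le_trans (esumZ_le _ _ _) _; rewrite ?powR_ge0//.
  by rewrite EFinM -muleA; apply: lee_wpmul2l => //; exact: esum_schur_up.
apply: le_esum => x _.
have := @tmean_powR_le x; set B := (_ * E x)%E => mean_le.
have B0 : (0 <= B)%E by exact: mule_ge0.
rewrite -[leRHS]poweRe1// -(@mulVf _ p) ?gt_eqF// poweRrM.
apply: gt0_ler_poweR; rewrite ?(ltW p0)// ?in_itv/= ?leey ?andbT ?poweR_ge0//.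
  exact: tmaximal_ge0.
apply: ge_ereal_sup => _ [r _ <-]; rewrite -/(tmean f x r).
rewrite -[leLHS]poweRe1 ?tmean_ge0// -(@divff _ p) ?gt_eqF// poweRrM.
apply: gt0_ler_poweR; rewrite ?invr_ge0 ?(ltW p0)// ?in_itv/= ?leey ?andbT ?poweR_ge0//.
Qed.

End strong_type.

(** A growth rate gam of the generations that is less than a ^ 2 and a ^ p is all
    that boundedness requires. *)
Lemma tmaximal_strong_type (k : int -> nat) (k_ge2 : forall d, (2 <= k d)%N)
    (a : nat) (k_gea : forall d, (a <= k d)%N) (R : realType) (C gam p : R) :
  (1 < a)%N -> 0 < gam -> (forall d j, (breadth k d j)%:R <= C * gam ^+ j) ->
  1 < p -> gam < a%:R ^+ 2 -> gam < a%:R `^ p ->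
  tmaximal_bounded (horo_tree k_ge2) p%:E.
Proof.
move=> a1 g0 bC p1 ga gap; have ar1 : (1 : R) < a%:R by rewrite ltr1n.
have [v [w [sig [v0 wE sig01 [ths vas vVs] [gws was]]]]] :=
  schur_parameters ar1 g0 p1 ga gap.
have p0 : 0 < p by apply: lt_trans p1.
set C1 := C / (1 - sig) ^+ 2.
have C10 : 0 <= C1.
  rewrite divr_ge0 ?(le_trans _ (breadth_const_ge1 bC))// exprn_ge0// subr_ge0.
  by case/andP: sig01 => _ /ltW.
exists ((C1 `^ (p - 1) * C1) `^ p^-1) => f _; rewrite Lnorm.unlock.
have := esum_tmaximal_le a1 k_gea g0 bC p1 v0 wE sig01 ths vas vVs gws was f.
have absM x : `|tmaximal f x|%E = tmaximal f x by rewrite gee0_abs// tmaximal_ge0.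
under [in X in (X `^ _ <= _)%E]eq_integral do rewrite absM.
rewrite !integral_tmeasure; try exact: countable_horo; last 2 first.
- by move=> x; exact: poweR_ge0.
- by move=> x; exact: poweR_ge0.
move=> H; rewrite -poweR_EFin -poweRM; last 2 first.
- by rewrite lee_fin mulr_ge0 ?powR_ge0.
- by apply: esum_ge0 => x _; exact: poweR_ge0.
apply: gt0_ler_poweR; rewrite ?invr_ge0 ?(ltW p0)// ?in_itv/= ?leey ?andbT//.
  by apply: esum_ge0 => x _; exact: poweR_ge0.
apply: mule_ge0; first by rewrite lee_fin mulr_ge0 ?powR_ge0.
by apply: esum_ge0 => x _; rewrite lee_fin; exact: powR_ge0.
Qed.

(** Averages do not exceed the supremum, and for the counting measure the essential
    supremum is the supremum. *)
Lemma tmaximal_bounded_pinfty (k : int -> nat) (k_ge2 : forall d, (2 <= k d)%N)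
    (R : realType) : tmaximal_bounded (horo_tree k_ge2) (+oo : \bar R)%E.
Proof.
set T := horo_tree k_ge2; exists 1 => f _; rewrite mul1e Lnorm.unlock.
case: ifPn => // _; set S := ess_sup _ (abse \o (EFin \o f)).
have fS (y : T) : (`|f y|%:E <= S)%E.
  rewrite leNgt; apply/negP => Sf.
  have [N [_ N0 SN]] : \forall y \ae tmeasure T R, ((abse \o (EFin \o f)) y <= S)%E.
    exact: ess_sup_ge.
  have /SN yN : ~ ((abse \o (EFin \o f)) y <= S)%E by apply/negP; rewrite -ltNge.
  have : (tmeasure T R [set y] <= tmeasure T R N)%E.
    by apply: le_measure; rewrite ?inE; try exact: measurable_tree; move=> _ ->.
  by rewrite tmeasure1 N0 leNgt lte01.
apply/ess_supP; near=> x.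
rewrite /= gee0_abs ?tmaximal_ge0//; apply: ge_ereal_sup => _ [r _ <-].
have cge0 : (0 < #|` fset_set (tball x r)|)%N.
  exact: leq_trans (breadth_gt0 k_ge2 _ _) (leq_card_tball x r).
apply: (@le_trans _ _ ((fine (tmeasure T R (tball x r)))^-1%:E *
    \int[tmeasure T R]_(y in tball x r) cst S y)%E).
  apply: lee_wpmul2l; first by rewrite lee_fin invr_ge0; exact: fine_ge0.
  apply: ge0_le_integral; try exact: measurable_fun_tree; try exact: measurable_tree.
  - by [].
  - by move=> y _; exact: fS.
rewrite integral_cst; last exact: measurable_tree.
rewrite tmeasure_tball [tmeasure _ _ _](_ : _ = (#|` fset_set (tball x r)|%:R)%:E); last first.
  rewrite -tmeasure_tball fineK// ge0_fin_numE// /tmeasure/= /counting.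
  by rewrite asboolT ?ltry//; exact: finite_tball.
rewrite muleCA -EFinM mulVf ?mule1// pnatr_eq0 -lt0n//.
Unshelve. all: by end_near. Qed.

(** * Unboundedness for fast growing generations *)

Section ball_size.
Variables (k : int -> nat) (k_ge2 : forall d, (2 <= k d)%N).
Let T := horo_tree k_ge2.
Local Notation anc i := (iter i (parent k)).

Definition shell m (x : site) : seq site :=
  [seq z | i <- iota 0 m.+1, z <- descendants k (m - i) (anc i x)].

Lemma mem_shell (x y : site) i j :
  anc i x = anc j y -> y \in shell (i + j) x.
Proof.
move=> xy; apply/allpairsPdep; exists i, y; split=> //.
  by rewrite mem_iota /= add0n ltnS leq_addr.
by rewrite mem_descendants// addKn xy.
Qed.

(** Replacing a common ancestor by one e levels higher adds 2 * e to the length of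
    the detour, so every detour can be stretched to length r or r - 1. *)
Lemma tball_shells (x : T) r : tball x r `<=` [set` shell r x ++ shell r.-1 x].
Proof.
move=> y; rewrite tballE => -[i [j [ij xy]]] /=.
pose e := (r - (i + j))./2.
have {}xy : anc (e + i) (x : site) = anc (e + j) (y : site) by rewrite !iterD xy.
rewrite mem_cat; have := mem_shell xy.
have [->|->] : (e + i + (e + j) = r \/ e + i + (e + j) = r.-1)%N by rewrite /e; lia.
- by move=> ->.
- by move=> ->; rewrite orbT.
Qed.

Variables (a : nat) (R : realType) (C gam : R).
Hypotheses (a_gt0 : (0 < a)%N) (k_gea : forall d, (a <= k d)%N)
  (gam_gt0 : 0 < gam) (a_gam : a%:R <= gam) (gam_lt : gam < a%:R ^+ 2)
  (breadth_le : forall d j, (breadth k d j)%:R <= C * gam ^+ j).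
Let th := gam / a%:R ^+ 2.

Lemma size_shell_le m (x : site) :
  (size (shell m x))%:R <= C / (1 - th) * (breadth k (x.1 + m%:Z) m)%:R.
Proof.
have ar0 : (0 : R) < a%:R by rewrite ltr0n.
have C0 : 0 <= C by exact: le_trans (breadth_const_ge1 breadth_le).
have th0 : 0 < th by rewrite divr_gt0 ?exprn_gt0.
have th1 : th < 1 by rewrite ltr_pdivrMr ?exprn_gt0// mul1r.
have ath : a%:R^-1 <= th.
  by rewrite ler_pdivlMr ?exprn_gt0// expr2 mulrA mulVf ?mul1r// gt_eqF.
rewrite size_allpairs_dep sumnE big_map natr_sum.
apply: (@le_trans _ _ (\sum_(i <- iota 0 m.+1)
    C * th ^+ i * (breadth k (x.1 + m%:Z) m)%:R)); last first.
  rewrite -mulr_suml ler_wpM2r// -mulr_sumr ler_wpM2l// geometric_sum_le//.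
  by rewrite th1 ltW.
rewrite big_seq [leRHS]big_seq; apply: ler_sum => i.
rewrite mem_iota /= add0n ltnS => im.
rewrite size_descendants site_level; set j := (m - i)%N.
have := breadth_ratio a_gt0 k_gea gam_gt0 breadth_le x.1 i j.
have -> : (i + j)%N = m by rewrite subnKC.
rewrite -ler_pdivlMr ?exprn_gt0//; move/le_trans; apply.
rewrite mulrAC ler_wpM2r// -mulrA ler_wpM2l//.
have [ij|/ltnW ji] := leqP i j.
  by have -> : (i - j)%N = 0%N; [apply/eqP; rewrite subn_eq0|rewrite expr0 divr1].
rewrite -[in leRHS](subnKC ji) exprD ler_wpM2l ?exprn_ge0 ?(ltW th0)// -exprVn.
by apply: lerXn2r => //; rewrite nnegrE ?invr_ge0 ltW.
Qed.

(** By [breadth_ratio] the shells are dominated by a geometric series, hence the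
    descendants of x make up a fixed proportion of the ball. *)
Lemma card_tball_le (x : T) r :
  (#|` fset_set (tball x r)|)%:R <=
  2 * (C / (1 - th)) * (breadth k ((x : site).1 + r%:Z) r)%:R.
Proof.
have c0 : 0 <= C / (1 - th).
  rewrite divr_ge0 ?(le_trans _ (breadth_const_ge1 breadth_le))// subr_ge0 ltW//.
  by rewrite ltr_pdivrMr ?exprn_gt0 ?ltr0n// mul1r.
apply: (@le_trans _ _ (size (shell r x ++ shell r.-1 x))%:R).
  rewrite ler_nat; apply: leq_trans (size_undup _); rewrite -card_fset_set_seq.
  apply: fsubset_leq_card; rewrite -fset_set_sub; last 2 first.
  - exact: finite_tball.
  - exact: finite_seq.
  exact: tball_shells.
rewrite size_cat natrD -mulrA mulr2n mulrDl mul1r lerD ?size_shell_le//.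
apply: le_trans (size_shell_le _ _) _; rewrite ler_wpM2l// ler_nat leq_breadth//.
exact: leq_pred.
Qed.

End ball_size.

(** The test function is a point mass at a site o. On the r-th generation below o,
    which has breadth d r members, its maximal function is at least the inverse of
    the size of the ball of radius r. *)
Lemma tmaximal_unbounded (k : int -> nat) (k_ge2 : forall d, (2 <= k d)%N)
    (R : realType) (c p : R) : 1 <= p -> 0 < c ->
  (forall (x : horo_tree k_ge2) r, (#|` fset_set (tball x r)|)%:R <=
     c * (breadth k ((x : site).1 + r%:Z) r)%:R) ->
  (forall M : R, exists d r,
     M * (breadth k (d + r%:Z) r)%:R `^ p <= (breadth k d r)%:R) ->
  ~ tmaximal_bounded (horo_tree k_ge2) p%:E.
Proof.
set T := horo_tree k_ge2 => p1 c0 ball_le unb [B HB].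
have p0 : 0 < p by apply: lt_le_trans p1.
have [d [r dr]] := unb (c `^ p * (`|B| `^ p + 1)).
pose o : T := (d - r%:Z, 0%N); pose f (y : T) : R := (y == o)%:R.
have fp (y : T) : `|f y| `^ p = (y == o)%:R.
  by rewrite /f; case: eqP => _; rewrite ?normr1 ?normr0 ?powR1 ?powR0 ?gt_eqF.
have Nf1 : ('N[tmeasure T R]_p%:E[EFin \o f] <= 1)%E.
  rewrite Lnorm.unlock -[leRHS](poweR1r p^-1); apply: gt0_ler_poweR.
  - by rewrite invr_ge0 ltW.
  - by rewrite in_itv/= leey andbT integral_ge0// => x _; exact: poweR_ge0.
  - by rewrite in_itv/= leey lee_fin ler01.
  rewrite integral_tmeasure; [|exact: countable_horo|by move=> x; exact: poweR_ge0].
  apply: le_trans (esum_le_supp (s := [:: o]) _ _) _.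
  - by move=> x; exact: poweR_ge0.
  - by move=> y; rewrite mem_seq1 /= fp => /negbTE ->.
  - by rewrite big_seq1 /= fp eqxx.
have fL : f \in Lfun (tmeasure T R) p%:E.
  rewrite inE; apply/andP; split; rewrite inE/=; first exact: measurable_fun_tree.
  exact: le_lt_trans Nf1 (ltry _).
have {}HB : ('N[tmeasure T R]_p%:E[tmaximal f] <= `|B|%:E)%E.
  apply: le_trans (HB f fL) _; rewrite -[leRHS]mule1.
  apply: (@le_trans _ _ (`|B|%:E * 'N[tmeasure T R]_p%:E[EFin \o f])%E).
    by apply: lee_wpmul2r; [exact: Lnorm_ge0|rewrite lee_fin ler_norm].
  by apply: lee_wpmul2l.
move: HB; rewrite Lnorm.unlock; set I := (\int[_]_x _)%E => HB.
have I0 : (0 <= I)%E by apply: integral_ge0 => x _; exact: poweR_ge0.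
have {}HB : (I <= (`|B| `^ p)%:E)%E.
  rewrite -[leLHS]poweRe1// -(@mulVf _ p) ?gt_eqF// poweRrM -poweR_EFin.
  by apply: gt0_ler_poweR; rewrite ?(ltW p0)// in_itv/= leey andbT ?poweR_ge0// lee_fin.
pose D : R := (breadth k (d + r%:Z) r)%:R.
have D0 : 0 < D by rewrite ltr0n breadth_gt0.
have cD0 : 0 < c * D by exact: mulr_gt0.
have : ((((c * D) `^ p)^-1 * (breadth k d r)%:R)%:E <= (`|B| `^ p)%:E)%E.
  apply: le_trans HB.
  rewrite /I integral_tmeasure; [|exact: countable_horo|by move=> x; exact: poweR_ge0].
  apply: le_trans (esum_ge_seq _ (uniq_descendants k r (o : site))).
  have -> : breadth k d r = size (descendants k r (o : site)).
    by rewrite size_descendants /= subrK.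
  rewrite -sum1_size natr_sum mulr_sumr -sumEFin big_seq [leRHS]big_seq.
  apply: lee_sum => x; rewrite mem_descendants// => /eqP xo.
  rewrite mulr1 -powRN -mulN1r powRrM powR_inv1 ?(ltW cD0)// -poweR_EFin.
  apply: gt0_ler_poweR;
    rewrite ?(ltW p0)// ?in_itv/= ?leey ?andbT ?lee_fin ?invr_ge0 ?(ltW cD0)//.
  apply: le_trans (lee_abs _); apply: le_trans (ereal_sup_ubound _); last by exists r.
  rewrite tmeasure_tball integral_tmeasure; last 2 first.
  - exact: countable_horo.
  - by move=> y; rewrite lee_fin.
  have cge0 : (0 < #|` fset_set (tball (x : T) r)|)%N.
    exact: leq_trans (breadth_gt0 k_ge2 _ _) (leq_card_tball (x : T) r).
  rewrite -[((c * D)^-1)%:E]mule1; apply: lee_pmul.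
  - by rewrite lee_fin invr_ge0 ltW.
  - by rewrite lee_fin.
  - rewrite lee_fin lef_pV2 ?posrE ?ltr0n//.
    apply: le_trans (ball_le _ _) _; rewrite ler_wpM2l ?(ltW c0)// /D.
    have -> : x.1 = d by have := site_level k x r; rewrite xo /= => /addIr <-.
    by [].
  - apply: esum_ge; exists [set o].
      split; first exact: finite_set1.
      by move=> _ ->; rewrite tballE; exists r, 0%N; rewrite addn0.
    by rewrite fsbig_set1 /f eqxx normr1.
rewrite lee_fin mulrC ler_pdivrMr ?powR_gt0// => H.
have := le_trans dr H; rewrite -/D (powRM _ (ltW c0) (ltW D0)) => {}H.
have X0 : 0 < c `^ p * D `^ p by rewrite mulr_gt0 ?powR_gt0.
move: H; rewrite (_ : _ * _ * _ = (`|B| `^ p + 1) * (c `^ p * D `^ p)); last by ring.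
by rewrite ler_pM2r// gerDl ler10.
Qed.

(** * The greedy sequence of degrees *)

Lemma NegzB1 n : Negz n - 1 = Negz n.+1.
Proof. lia. Qed.

Lemma PoszSB1 n : Posz n.+1 - 1 = Posz n.
Proof. lia. Qed.

Section greedy_degrees.
Variables (R : realType) (a b n0 : nat) (A : R).
Hypotheses (a_ge2 : (2 <= a)%N) (ltab : (a < b)%N) (n0_ge2 : (2 <= n0)%N)
  (a_leA : a%:R <= A) (n0P : A * n0.+1%:R <= b%:R * n0%:R) (A_leb : A <= b%:R).
Implicit Types (n m j r : nat) (d : int).

(** The factor n + n0 is negligible against any exponential but unbounded; it is the
    reason why the operator is unbounded at the critical exponent itself. *)
Definition target n : R := A ^+ n * (n + n0)%:R.

(** Comparing the product of the degrees chosen so far with the target keeps the two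
    within a constant factor of each other, see [greedy_prod_le] and
    [target_le_greedy]. *)
Fixpoint greedy_prod n : nat :=
  if n is m.+1 then
    (greedy_prod m * if ((greedy_prod m)%:R < target m)%R then b else a)%N
  else 1%N.

(** The greedy sequence is read upwards from level -1, so that its n-th product counts
    the descendants at level -1 of a site n levels above. *)
Definition greedy_degree d : nat :=
  match d with
  | Posz _ => a
  | Negz n => if (greedy_prod n)%:R < target n then b else a
  end.

Let k := greedy_degree.
Let D n : R := (greedy_prod n)%:R.

Lemma greedy_degree_ge d : (a <= k d)%N.
Proof. by case: d => n //=; rewrite /k /=; case: ifP => _ //; exact: ltnW. Qed.

Lemma greedy_degree_le d : (k d <= b)%N.
Proof. by case: d => n /=; rewrite /k /=; [|case: ifP => _ //]; exact: ltnW. Qed.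

Let a0 : (0 : R) < a%:R. Proof. by rewrite ltr0n ltnW. Qed.
Let a1 : (1 : R) <= a%:R. Proof. by rewrite ler1n ltnW. Qed.
Let A0 : 0 < A. Proof. exact: lt_le_trans a_leA. Qed.
Let A1 : 1 <= A. Proof. exact: le_trans a_leA. Qed.
Let b1 : (1 : R) <= b%:R. Proof. exact: le_trans A_leb. Qed.
Let b0 : (0 : R) <= b%:R. Proof. by rewrite ler0n. Qed.
Let n01 : (1 : R) <= n0%:R. Proof. by rewrite ler1n ltnW. Qed.

Let greedy_prodS n : D n.+1 = D n * (if D n < target n then b else a)%:R.
Proof. by rewrite /D /= natrM. Qed.

Lemma target_gt0 n : 0 < target n.
Proof. by rewrite mulr_gt0 ?exprn_gt0// ltr0n addn_gt0 (ltnW n0_ge2) orbT. Qed.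

Lemma target_leS n : a%:R * target n <= target n.+1.
Proof.
rewrite /target exprS mulrA; apply: ler_pM; rewrite ?mulr_ge0 ?exprn_ge0 ?(ltW A0) ?(ltW a0)//.
  by rewrite ler_wpM2r// exprn_ge0// ltW.
by rewrite ler_nat leq_add2r.
Qed.

Lemma targetS_le n : target n.+1 <= b%:R * target n.
Proof.
rewrite /target exprSr mulrCA -mulrA ler_wpM2l ?exprn_ge0 ?(ltW A0)//.
rewrite addSnnS !natrD !mulrDr lerD// ler_wpM2r//.
Qed.

(** The product is multiplied by b only while it is below the target, and by a, which
    is at most the growth of the target, afterwards. *)
Lemma greedy_prod_le n : D n <= b%:R * target n.
Proof.
elim: n => [|n IH].
  have -> : D 0 = 1 by [].
  by rewrite /target expr0 mul1r add0n -[leLHS]mulr1 ler_pM.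
rewrite greedy_prodS; case: ifPn => [/ltW lt|_].
  rewrite mulrC ler_wpM2l//; apply: le_trans lt _.
  by apply: le_trans (target_leS n); rewrite ler_peMl// ltW// target_gt0.
apply: le_trans (ler_wpM2l b0 (target_leS n)).
by rewrite mulrC mulrCA ler_wpM2l// ltW.
Qed.

(** Below the target the product grows by b, at least as fast as the target; otherwise
    it exceeds the target already, and one step costs a factor b at most. *)
Lemma target_le_greedy n : target n <= b%:R * n0%:R * D n.
Proof.
elim: n => [|n IH].
  have -> : D 0 = 1 by [].
  by rewrite /target expr0 mul1r add0n mulr1 ler_peMl.
apply: le_trans (targetS_le n) _; rewrite greedy_prodS; case: ifPn => [_|].
  by rewrite [leRHS]mulrA [leRHS]mulrC ler_wpM2l.
rewrite -leNgt => le; rewrite -!mulrA ler_wpM2l//; apply: le_trans le _.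
rewrite mulrCA ler_peMr ?ler0n// -[leLHS]mulr1; exact: ler_pM.
Qed.

Lemma breadth_greedy n j : D n * (breadth k (Negz n) j)%:R = D (n + j).
Proof.
elim: j n => [|j IH] n; first by rewrite breadth0 mulr1 addn0.
rewrite breadthS NegzB1.
by rewrite natrM mulrA addnS -addSn -IH greedy_prodS.
Qed.

Lemma breadth_flat r : breadth k (-1 + r%:Z) r = (a ^ r)%N.
Proof.
elim: r => [|r IH]; first by rewrite breadth0.
by rewrite breadthS expnS -IH addrC PoszSB1 addrC.
Qed.

(** Any rate gam > A absorbs the polynomial factor j + 1 that the target contributes
    over a window of length j. *)
Lemma breadth_greedy_le gam : A < gam ->
  exists C, forall d j, (breadth k d j)%:R <= C * gam ^+ j.
Proof.
move=> Ag; pose rho := gam / A - 1.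
have rho0 : 0 < rho by rewrite subr_gt0 ltr_pdivlMr// mul1r.
pose C' := 1 + rho^-1; have C'0 : 0 <= C' by rewrite addr_ge0// invr_ge0 ltW.
have growth j : A ^+ j * j.+1%:R <= C' * gam ^+ j.
  have -> : gam ^+ j = A ^+ j * (1 + rho) ^+ j.
    by rewrite -exprMn /rho addrC subrK mulrC divfK// gt_eqF.
  rewrite mulrCA ler_wpM2l ?exprn_ge0 ?(ltW A0)//.
  apply: le_trans (ler_wpM2l C'0 (bernoulli_ge j (ltW rho0))).
  have -> : C' * (1 + j%:R * rho) = 1 + j%:R + rho^-1 + j%:R * rho.
    by rewrite /C'; field; rewrite gt_eqF.
  rewrite -natr1; have : 0 <= j%:R * rho by rewrite mulr_ge0// ltW.
  have : 0 < rho^-1 by rewrite invr_gt0.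
  lra.
pose K := b%:R * n0%:R : R.
have K1 : 1 <= K by rewrite -[leLHS]mulr1 ler_pM.
pose C := b%:R * K * C'.
have C1 : 1 <= C.
  rewrite -[leLHS]mulr1 ler_pM//; first by rewrite -[leLHS]mulr1 ler_pM.
  by rewrite lerDl invr_ge0 ltW.
have neg n j : (breadth k (Negz n) j)%:R <= C * gam ^+ j.
  have Dn : 0 < D n.
    have := lt_le_trans (target_gt0 n) (target_le_greedy n).
    by rewrite pmulr_rgt0// (lt_le_trans _ K1).
  rewrite -(ler_pM2l Dn) breadth_greedy; apply: le_trans (greedy_prod_le _) _.
  rewrite (_ : D n * _ = b%:R * (K * D n * (C' * gam ^+ j))); last first.
    by rewrite /C; ring.
  rewrite ler_wpM2l//; apply: (@le_trans _ _ (target n * (A ^+ j * j.+1%:R))).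
    rewrite /target exprD -!mulrA ler_wpM2l ?exprn_ge0 ?(ltW A0)//.
    rewrite [leRHS]mulrCA ler_wpM2l ?exprn_ge0 ?(ltW A0)// -natrM ler_nat.
    by move: n0_ge2; clear; nia.
  apply: ler_pM => //; first exact/ltW/target_gt0.
    by rewrite mulr_ge0// exprn_ge0// ltW.
  exact: target_le_greedy.
exists C => -[m|n] j; last exact: neg.
have a_gam : a%:R <= gam by exact: le_trans (ltW Ag).
elim: m j => [|m IH] [|j].
- by rewrite breadth0 expr0 mulr1.
- rewrite breadthS natrM exprS mulrCA; apply: ler_pM; rewrite ?ler0n//.
  exact: neg.
- by rewrite breadth0 expr0 mulr1.
by rewrite breadthS natrM exprS mulrCA PoszSB1; apply: ler_pM; rewrite ?ler0n.
Qed.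

Lemma greedy_degree_max : k (Negz 0) = b.
Proof. by rewrite /k /= /target expr0 mul1r add0n ltr1n n0_ge2. Qed.

(** Below a site r levels above level -1 there are at least a constant times
    A ^ r * (r + n0) sites of level -1. *)
Lemma breadth_greedy_unbounded (M : R) : exists r,
  M * A ^+ r <= (breadth k (Negz 0) r)%:R.
Proof.
pose K := b%:R * n0%:R : R.
have K0 : 0 < K by rewrite mulr_gt0 ?(lt_le_trans _ b1)// (lt_le_trans _ n01).
pose r := Num.bound (K * `|M|); exists r.
have := breadth_greedy 0 r; rewrite {1}/D /= mul1r add0n => ->.
rewrite -(ler_pM2l K0); apply: le_trans (target_le_greedy r).
rewrite /target mulrA [leRHS]mulrC ler_wpM2r ?exprn_ge0 ?(ltW A0)//.
apply: (@le_trans _ _ r%:R); last by rewrite ler_nat leq_addr.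
apply: le_trans (ltW (archi_boundP _)); last by rewrite mulr_ge0// ltW.
by rewrite ler_wpM2l ?ler_norm// ltW.
Qed.

End greedy_degrees.

(** * The critical exponent *)

Theorem proposition3p4 (R : realType) (a b : nat) (q : R)
  (ha : (2 <= a)%N) (hab : (a < b)%N) (hba : (b <= a ^ 2)%N)
  (tau := (ln b%:R / ln a%:R)%R : R) (hq : (1 < q < tau)%R)
  (eps : R) (heps : (0 < eps)%R) (hqeps : (1 < q - eps)%R) :
  exists (s : R) (T : tree),
    [/\ (1 < q - eps < s)%R, (s <= q)%R, Upsilon T a b &
        forall p : \bar R, (1 <= p)%E ->
          (tmaximal_bounded T p <-> (s%:E < p)%E)].
Proof.
have /andP[q1 qtau] := hq.
have a1 : (1 : R) < a%:R by rewrite ltr1n.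
have a0 : (0 : R) < a%:R by rewrite ltr0n ltnW.
pose A : R := a%:R `^ q.
have aA : a%:R < A by rewrite -[ltLHS](powRr1 (ltW a0)); exact: ltr_powR2l.
have Ab : A < b%:R.
  have b0 : (0 : R) < b%:R by rewrite ltr0n (leq_ltn_trans _ hab).
  by rewrite -(powR_log a1 b0); exact: ltr_powR2l.
have Aa2 : A < a%:R ^+ 2 by apply: lt_le_trans Ab _; rewrite -natrX ler_nat.
(* n0 is so large that the target grows by at most b per step; the additional 2
   makes the first greedy degree equal to b. *)
pose n0 := (Num.bound (A / (b%:R - A))).+2.
have n0_ge2 : (2 <= n0)%N by [].
have bA0 : 0 < b%:R - A by rewrite subr_gt0.
have n0P : A * n0.+1%:R <= b%:R * n0%:R.
  rewrite -natr1 mulrDr mulr1 addrC -lerBrDr -mulrBl mulrC -ler_pdivrMr//.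
  apply: le_trans (ltW (archi_boundP _)) _; first by rewrite divr_ge0// ltW// (lt_trans a0).
  by rewrite ler_nat; exact/leqW/leqW.
pose k := greedy_degree a b n0 A.
have kge d : (a <= k d)%N by exact: greedy_degree_ge.
have kge2 d : (2 <= k d)%N by exact: leq_trans (kge d).
pose T := horo_tree kge2.
have breadth_bound gam := @breadth_greedy_le R a b n0 A ha n0_ge2 (ltW aA) n0P (ltW Ab) gam.
exists q, T; split=> //.
- by rewrite hqeps ltrBlDr ltrDl.
- split=> [x||].
  + by rewrite nu_horo !ltnS kge greedy_degree_le.
  + by exists ((-1, 0%N) : T); rewrite nu_horo.
  + exists ((Negz 1, 0%N) : T); rewrite nu_horo; congr _.+1.
    exact: greedy_degree_max.
case=> [p| |//] p1; last first.
  by split=> _; [exact: ltry|exact: tmaximal_bounded_pinfty].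
rewrite lee_fin in p1; rewrite lte_fin; split; last first.
  move=> qp; have Ap : A < a%:R `^ p by exact: ltr_powR2l.
  have Amin : A < Num.min (a%:R ^+ 2) (a%:R `^ p) by rewrite lt_min Aa2 Ap.
  have [Agam] := midf_lt Amin; set gam := (_ / 2); rewrite lt_min => /andP[g2 gp].
  have [C HC] := breadth_bound gam Agam.
  apply: (tmaximal_strong_type _ kge ha _ HC) => //; last exact: lt_trans q1 qp.
  exact: lt_trans (lt_trans a0 aA) Agam.
apply: contraPT; rewrite -leNgt => pq.
have [Agam] := midf_lt Aa2; set gam := (_ / 2) => g2.
have [C HC] := breadth_bound gam Agam.
have agam : a%:R < gam by exact: lt_trans Agam.
have g0 : 0 < gam by exact: lt_trans agam.
have c0 : 0 < 2 * (C / (1 - gam / a%:R ^+ 2)).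
  rewrite mulr_gt0// divr_gt0 ?(lt_le_trans _ (breadth_const_ge1 HC))// subr_gt0.
  by rewrite ltr_pdivrMr ?exprn_gt0// mul1r.
apply: (tmaximal_unbounded p1 c0).
  by move=> x r; apply: card_tball_le => //; [exact: ltnW|exact: ltW].
move=> M; have [r Mr] := breadth_greedy_unbounded ha n0_ge2 (ltW aA) n0P (ltW Ab) `|M|.
exists (Negz 0), r; apply: le_trans Mr.
rewrite breadth_flat natrX powR_exprn; last exact: ltW.
apply: (@le_trans _ _ (`|M| * (a%:R `^ p) ^+ r)).
  by rewrite ler_wpM2r ?exprn_ge0 ?powR_ge0// ler_norm.
rewrite ler_wpM2l//; apply: lerXn2r; rewrite ?nnegrE ?powR_ge0//.
by apply: ler_powR => //; exact: ltW.
Qed.
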